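(* Let $n\ge3$, $0\le m\le\lfloor n^2/4\rfloor$, and $t:=\min_{0\le j\le\lfloor n/2\rfloor}|m-j(n-j)|$. Then $\rho(H_{n,m})=n-1-\xi$, where $\xi$ is the smallest real number satisfying $\xi(n-\xi)^2=4t(n-1-t)$. In particular, $$\frac{4t(n-1-t)}{n^2}\le\xi\le\frac{4t(n-1-t)}{(n-1)^2}.$$
   Context: For a simple graph $H$ with vertices $v_1,\dots,v_n$, the Seidel matrix $\mathcal S(H)=(s_{ij})$ has $s_{ii}=0$, and for $i\ne j$, $s_{ij}=-1$ if $v_i,v_j$ are adjacent and $s_{ij}=1$ otherwise; $\rho(H)$ is the largest eigenvalue of $\mathcal S(H)$. Definition of $H_{n,m}$: let $d\in\{0,\dots,\lfloor n/2\rfloor\}$ be such that $d(n-d)$ is a number among $0,n-1,2(n-2),\dots,\lfloor n/2\rfloor\lceil n/2\rceil$ closest to $m$, and $t=|m-d(n-d)|$. If $m<d(n-d)$, $H_{n,m}$ is obtained from the complete bipartite graph $K_{d,n-d}$ by removing the edges of a star $K_{1,t}$ contained in it; if $m\ge d(n-d)$, $H_{n,m}$ is obtained from $K_{d,n-d}$ by adding the edges of a star $K_{1,t}$ whose vertices all lie in one of the two parts. *)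

(* Defs.v *)
From mathcomp Require Import all_boot all_order all_algebra.
From mathcomp Require Import reals.

Set Implicit Arguments.
Unset Strict Implicit.
Unset Printing Implicit Defensive.

Import Order.TTheory GRing.Theory Num.Theory.
Local Open Scope ring_scope.

Record sgraph (n : nat) := SGraph {
  adj :> rel 'I_n;
  adj_sym : symmetric adj;
  adj_irr : irreflexive adj }.

Definition seidel (R : nzRingType) (n : nat) (G : sgraph n) : 'M[R]_n :=
  \matrix_(i, j) (if i == j then 0 else if adj G i j then -1 else 1).

Definition largest_eigenvalue (R : realType) (n : nat) (A : 'M[R]_n) (r : R) :=
  eigenvalue A r /\ forall a : R, eigenvalue A a -> a <= r.

(* For j <= n./2 the truncated subtraction n - j is exact. *)
Definition bip_dist (n m j : nat) : nat := `|m%:Z - (j * (n - j))%N%:Z|%N.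

(* The default value m of the minimum is also its term at j = 0. *)
Definition min_bip_dist (n m : nat) : nat :=
  (\big[minn/m]_(j < n./2.+1) bip_dist n m j)%N.

(* Adjacency in the complete bipartite graph with parts A and ~: A. *)
Definition bip_rel (n : nat) (A : {set 'I_n}) : rel 'I_n :=
  fun u v => (u \in A) != (v \in A).

(* Adjacency in the star with centre c and set of leaves L. *)
Definition star_rel (n : nat) (c : 'I_n) (L : {set 'I_n}) : rel 'I_n :=
  fun u v => ((u == c) && (v \in L)) || ((v == c) && (u \in L)).

(* G is a labelled copy of H_{n,m}, for some admissible choice of d, of the    *)
(* bipartition and of the star.                                                *)
Definition is_Hnm (n m : nat) (G : sgraph n) : Prop :=
  exists (d : nat) (A : {set 'I_n}) (c : 'I_n) (L : {set 'I_n}),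
    [/\ (d <= n./2)%N,
        forall j : nat, (j <= n./2)%N -> (bip_dist n m d <= bip_dist n m j)%N,
        #|A| = d,
        c \notin L /\ #|L| = bip_dist n m d
      & if (m < d * (n - d))%N then
          subrel (star_rel c L) (bip_rel A) /\
          forall u v, adj G u v = bip_rel A u v && ~~ star_rel c L u v
        else
          (c |: L \subset A \/ c |: L \subset ~: A) /\
          forall u v, adj G u v = bip_rel A u v || star_rel c L u v].

Definition smallest_sol (R : realType) (P : R -> Prop) (x : R) :=
  P x /\ forall y : R, P y -> x <= y.

(* Main.v *)
Require Import Defs.
From mathcomp Require Import all_boot all_order all_algebra.
From mathcomp Require Import reals.
From mathcomp Require Import ring lra zify.

Import Order.TTheory GRing.Theory Num.Theory.
Local Open Scope ring_scope.

(** H_{n,m} is the symmetric difference of a complete bipartite graph with a star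
    with t leaves, so conjugating its Seidel matrix by the sign vector of the
    bipartition gives J - I - 2 S, where S is the adjacency matrix of the star.
    An eigenvector y for the eigenvalue a is governed by the value p of y at the
    centre, its sum q over the leaves and its total sum s: with l = a + 1 and
    x = n - l,
      l p = s - 2 q,   l q = t (s - 2 p),   x s = 2 q + 2 t p.
    The determinant of this system is 4 t (n - 1 - t) - x l^2, so an eigenvalue
    with l <> 0 yields a root of the cubic and conversely.  On [0, 1] the function
    x (n - x)^2 increases from 0 to (n - 1)^2 >= 4 t (n - 1 - t), so the smallest
    root of the cubic lies there. *)

(** * Reduction to a bipartite graph xor a star *)

Lemma min_bip_dist_eq (n m d : nat) : (d <= n./2)%N ->
  (forall j, (j <= n./2)%N -> (bip_dist n m d <= bip_dist n m j)%N) ->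
  min_bip_dist n m = bip_dist n m d.
Proof.
move=> hd dmin; apply/eqP; rewrite eqn_leq; apply/andP; split.
  have hd' : (d < n./2.+1)%N by [].
  rewrite /min_bip_dist; have := mem_index_enum (Ordinal hd').
  elim: (index_enum _) => [//|j r IHr]; rewrite inE big_cons geq_min.
  by move=> /orP[/eqP <-|/IHr ->]; rewrite ?leqnn ?orbT.
rewrite /min_bip_dist; elim/big_ind: _ => [|x y hx hy|j _].
(* The default value [m] of the minimum is the distance at [j = 0]. *)
- by apply: leq_trans (dmin 0 (leq0n _)) _; rewrite /bip_dist; lia.
- by rewrite leq_min hx hy.
- by apply: dmin; rewrite -ltnS.
Qed.

(** A deleted star consists of edges of the bipartite graph and an added star of non-edges, so both
    operations are the same symmetric difference. *)
Lemma is_Hnm_xor (n m : nat) (G : sgraph n) : is_Hnm m G ->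
  exists (A : {set 'I_n}) (c : 'I_n) (L : {set 'I_n}),
    [/\ c \notin L, #|L| = min_bip_dist n m
      & forall u v, adj G u v = bip_rel A u v (+) star_rel c L u v].
Proof.
case=> d [A [c [L [hd dmin _ [cL hL] hadj]]]]; exists A, c, L.
split=> //; first by rewrite hL (min_bip_dist_eq _ _ _ hd dmin).
case: ifP hadj => _ [hsub hadj] u v; rewrite hadj.
  by move: (hsub u v); case: (star_rel _ _ _ _) => [->|_] //; rewrite andbT addbF.
case E: (star_rel c L u v); last by rewrite orbF addbF.
suff -> : bip_rel A u v = false by [].
suff h : (c |: L \subset A \/ c |: L \subset ~: A) ->
    forall w, w \in L -> (w \in A) = (c \in A).
  by move: E; rewrite /star_rel /bip_rel
    => /orP[] /andP[/eqP-> wL]; rewrite (h hsub _ wL) eqxx.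
case=> /subsetP s w wL; move: (s w) (s c); rewrite !inE wL eqxx orbT /=.
  by move=> -> // ->.
by move=> /(_ isT)/negbTE -> /(_ isT)/negbTE ->.
Qed.

(** * The cubic and its smallest root *)

Section SmallestRoot.
Variables (R : realType) (n t : R).
Local Notation f x := (x * (n - x) ^+ 2).
Local Notation k := (4 * t * (n - 1 - t)).

Lemma cubic_rhs_ge0 : 0 <= t <= n - 1 -> 0 <= k.
Proof. by move=> /andP[t0 tn]; rewrite !mulr_ge0 //; lra. Qed.

Lemma cubic_rhs_le : k <= (n - 1) ^+ 2.
Proof. by have := sqr_ge0 (n - 1 - 2 * t); rewrite !expr2; lra. Qed.

Lemma cubic_root_exists : 0 <= t <= n - 1 ->
  exists2 x : R, 0 <= x <= 1 & f x = k.
Proof.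
move=> tn; pose p : {poly R} := 'X * (n%:P - 'X) ^+ 2 - k%:P.
have pE y : p.[y] = f y - k.
  by rewrite /p !(hornerD, hornerN, hornerM, horner_exp, hornerX, hornerC).
have p01 : p.[0] <= 0 <= p.[1].
  by rewrite !pE mul0r sub0r oppr_le0 cubic_rhs_ge0 // subr_ge0 mul1r cubic_rhs_le.
have [x x01 /rootP px] := poly_ivt ler01 p01.
by exists x => //; apply/eqP; rewrite -subr_eq0 -pE px.
Qed.

Lemma cubic_root_le (x y : R) : 3 <= n -> 0 <= t <= n - 1 ->
  0 <= x <= 1 -> f x = k -> f y = k -> x <= y.
Proof.
move=> n3 tn /andP[x0 x1] fx fy; rewrite leNgt; apply/negP => yx.
have [y0|y0] := ltP y 0.
  have : f y < 0 by rewrite pmulr_llt0 // exprn_gt0 //; lra.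
  by rewrite fy ltNge cubic_rhs_ge0.
(* This factors f x - f y. For 0 <= y < x <= 1 the second factor is positive, since n - (x + y) > 1
   >= x y. *)
have /eqP : (x - y) * ((n - (x + y)) ^+ 2 - x * y) = 0.
  by transitivity (f x - f y); [ring | rewrite fx fy subrr].
rewrite mulf_eq0 !subr_eq0 => /orP[/eqP|/eqP xy]; first lra.
have : x * y <= 1 by apply: mulr_ile1 => //; lra.
have : 1 < (n - (x + y)) ^+ 2 by rewrite exprn_egt1 //; lra.
by rewrite xy; lra.
Qed.

(** For x in [0, 1] the factor (n - x)^2 lies between (n - 1)^2 and n^2. *)
Lemma cubic_root_bounds (x : R) : 3 <= n -> 0 <= x <= 1 -> f x = k ->
  k / n ^+ 2 <= x <= k / (n - 1) ^+ 2.
Proof.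
move=> n3 /andP[x0 x1] fx.
rewrite ler_pdivrMr ?ler_pdivlMr; try by apply: exprn_gt0; lra.
rewrite -fx !ler_wpM2l // ler_sqr ?nnegrE; lra.
Qed.

End SmallestRoot.

(** * The three-variable quotient system *)

(* The equations satisfied by the centre value p, the leaf sum q and the total
   sum s of an eigenvector. *)
Definition quotient_system {R : nzRingType} (l x t p q s : R) : Prop :=
  [/\ l * p = s - 2 * q, l * q = t * (s - 2 * p) & x * s = 2 * q + 2 * t * p].

(* Each coordinate times the determinant of the system vanishes (Cramer). *)
Lemma quotient_system_det (R : realType) (l x t p q s : R) :
  quotient_system l x t p q s -> (p, q, s) <> (0, 0, 0) ->
  x * l ^+ 2 = 4 * t * (l + x - 1 - t).
Proof.
case=> e1 e2 e3 nz; apply/eqP; rewrite -subr_eq0; apply/eqP.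
set D := _ - _; have [//|D0] := eqVneq D 0; case: nz.
have e u : D * u = 0 -> u = 0 by move/eqP; rewrite mulf_eq0 (negPf D0) => /eqP.
have f1 : l * p - s + 2 * q = 0 by rewrite e1; ring.
have f2 : l * q - t * (s - 2 * p) = 0 by rewrite e2; ring.
have f3 : x * s - 2 * q - 2 * t * p = 0 by rewrite e3; ring.
congr (_, _, _); apply: e; rewrite /D.
(* The multipliers here and in the next two cases are the rows of the adjugate of the system. *)
- transitivity ((l * x - 2 * t) * (l * p - s + 2 * q)
    + (2 - 2 * x) * (l * q - t * (s - 2 * p))
    + (l - 2 * t) * (x * s - 2 * q - 2 * t * p)); first by ring.
  by rewrite f1 f2 f3 !mulr0 !addr0.
- transitivity ((2 * t ^+ 2 - 2 * t * x) * (l * p - s + 2 * q)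
    + (l * x - 2 * t) * (l * q - t * (s - 2 * p))
    + (t * l - 2 * t) * (x * s - 2 * q - 2 * t * p)); first by ring.
  by rewrite f1 f2 f3 !mulr0 !addr0.
- transitivity ((2 * t * l - 4 * t) * (l * p - s + 2 * q)
    + (2 * l - 4 * t) * (l * q - t * (s - 2 * p))
    + (l ^+ 2 - 4 * t) * (x * s - 2 * q - 2 * t * p)); first by ring.
  by rewrite f1 f2 f3 !mulr0 !addr0.
Qed.

Lemma quotient_system_solvable (R : realType) (l x t : R) : 0 < l ->
  x * l ^+ 2 = 4 * t * (l + x - 1 - t) ->
  exists p q s : R, quotient_system l x t p q s /\ (p, q, s) <> (0, 0, 0).
Proof.
move=> l_gt0 e.
(* The cofactor solution of the generic case vanishes exactly at l = 2, t = 1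
   (which occurs for n = 3, m = 1). *)
have [/andP[/eqP l2 /eqP t1]|nd] := boolP ((l == 2) && (t == 1)).
  exists 1, (-1), 0; split; first by rewrite l2 t1; split; ring.
  by case=> /eqP; rewrite oner_eq0.
(* These are the cofactors of the third equation: the first two equations hold identically, and the
   third says that the determinant vanishes. *)
exists (l - 2 * t), (t * (l - 2)), (l ^+ 2 - 4 * t); split.
  split; [ring | ring |].
  apply/eqP; rewrite -subr_eq0; apply/eqP.
  transitivity (x * l ^+ 2 - 4 * t * (l + x - 1 - t)); first by ring.
  by rewrite e subrr.
case=> lt /eqP; rewrite mulf_eq0 => /orP[/eqP t0|/eqP l2] _; first by lra.
by move/negP: nd; apply; apply/andP; split; apply/eqP; lra.
Qed.

(** * Eigenvalues of the Seidel matrix *)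

Section SwitchedStar.
Variables (R : realType) (n : nat) (G : sgraph n) (A L : {set 'I_n}) (c : 'I_n).
Hypothesis cL : c \notin L.
Hypothesis adjE : forall u v, adj G u v = bip_rel A u v (+) star_rel c L u v.

Let sgn (i : 'I_n) : R := (-1) ^+ (i \in A).
Let t : R := #|L|%:R.

Lemma sgn_sqr i : sgn i * sgn i = 1.
Proof. by rewrite /sgn; case: (i \in A); rewrite ?expr1 ?expr0; ring. Qed.

(** Off the diagonal, the sign of an xor is the product of the signs: [sgn i * sgn j] for the
    bipartite graph and 1 - 2 S_ij for the star. *)
Lemma seidel_switched i j : seidel R G i j =
  sgn i * sgn j * (1 - (i == j)%:R
    - 2 * ((i == c)%:R * (j \in L)%:R + (j == c)%:R * (i \in L)%:R)).
Proof.
rewrite mxE adjE /bip_rel /star_rel; have [<-|ij] := eqVneq i j.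
  by have [->|_] := eqVneq i c; rewrite ?(negPf cL) /=; ring.
have ncL k : ~~ ((k == c) && (k \in L)).
  by apply: contra cL => /andP[/eqP ->].
rewrite /sgn; move: (ncL i) (ncL j).
case: (i == c); case: (i \in L); case: (j == c); case: (j \in L) => //= _ _;
  by case: (i \in A); case: (j \in A); rewrite /= ?expr0 ?expr1; ring.
Qed.

Lemma sum_indicator (F : 'I_n -> R) : \sum_i F i * (i == c)%:R = F c.
Proof.
rewrite (bigD1 c) //= eqxx mulr1 big1 ?addr0 // => i /negPf ->.
by rewrite mulr0.
Qed.

Lemma sum_indicator_set (F : 'I_n -> R) :
  \sum_i F i * (i \in L)%:R = \sum_(i in L) F i.
Proof.
rewrite [RHS]big_mkcond /=; apply: eq_bigr => i _.
by case: (i \in L); rewrite ?mulr1 ?mulr0.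
Qed.

Lemma seidel_switched_mul (y : 'I_n -> R) j :
  ((\row_i (sgn i * y i)) *m seidel R G) 0 j =
  sgn j * (\sum_i y i - y j
    - 2 * ((j \in L)%:R * y c + (j == c)%:R * \sum_(i in L) y i)).
Proof.
rewrite mxE -sum_indicator_set -[y c]sum_indicator.
have -> : y j = \sum_i y i * (i == j)%:R.
  rewrite (bigD1 j) //= eqxx mulr1 big1 ?addr0 // => i /negPf ->.
  by rewrite mulr0.
rewrite !mulr_sumr -big_split /= mulr_sumr -!sumrB mulr_sumr.
apply: eq_bigr => i _; rewrite mxE seidel_switched.
transitivity ((sgn i * sgn i) * (sgn j * y i * (1 - (i == j)%:R
    - 2 * ((i == c)%:R * (j \in L)%:R + (j == c)%:R * (i \in L)%:R)))).
  by ring.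
by rewrite sgn_sqr; ring.
Qed.

(** The coordinates y are those of an eigenvector after switching signs; moving -I to the left turns
    a into a + 1. *)
Lemma seidel_eigenvalueP (a : R) : eigenvalue (seidel R G) a <->
  exists2 y : 'I_n -> R, (exists i, y i != 0) &
    forall j, (a + 1) * y j = \sum_i y i
      - 2 * ((j \in L)%:R * y c + (j == c)%:R * \sum_(i in L) y i).
Proof.
split=> [/eigenvalueP[v va v0]|[y [i yi0] ye]].
  pose y i := sgn i * v 0 i.
  have vE : v = \row_i (sgn i * y i).
    by apply/rowP => i; rewrite mxE /y mulrA sgn_sqr mul1r.
  exists y.
    have [i vi] : exists i, v 0 i != 0.
      by apply/rV0Pn.
    exists i; apply: contra vi => /eqP yi.
    by rewrite vE mxE yi mulr0.
  move=> j; have := congr1 (fun w : 'rV_n => sgn j * w 0 j) va.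
  rewrite /= {1}vE seidel_switched_mul !mxE mulrA sgn_sqr mul1r.
  by rewrite [RHS]mulrCA -/(y j) => e; rewrite mulrDl mul1r -e; ring.
apply/eigenvalueP; exists (\row_i (sgn i * y i)).
  apply/rowP => j; rewrite seidel_switched_mul !mxE.
  by rewrite addrAC -ye; ring.
apply/rV0Pn; exists i; rewrite mxE mulf_neq0 //.
by rewrite /sgn signr_eq0.
Qed.

Lemma sum_star_value (s p q : R) :
  \sum_j (s - 2 * ((j \in L)%:R * p + (j == c)%:R * q))
    = n%:R * s - 2 * (t * p + q).
Proof.
rewrite sumrB sumr_const card_ord mulr_natl -mulr_sumr big_split /= -!mulr_suml.
rewrite -[q in RHS]mul1r; congr (_ - _ * (_ * _ + _ * _)).
  rewrite /t -sum1_card natr_sum [RHS]big_mkcond.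
  by apply: eq_bigr => j _; case: (j \in L).
by rewrite -[RHS](sum_indicator (fun=> 1)); apply: eq_bigr => j _; rewrite mul1r.
Qed.

Lemma sum_star_value_leaves (s p q : R) :
  \sum_(j in L) (s - 2 * ((j \in L)%:R * p + (j == c)%:R * q))
    = t * (s - 2 * p).
Proof.
rewrite (eq_bigr (fun=> s - 2 * p)) => [|j jL].
  by rewrite sumr_const -[LHS]mulr_natl.
have jc : (j == c) = false by apply: contraNF cL => /eqP <-.
by rewrite jL jc mul1r mul0r addr0.
Qed.

Lemma star_value_centre (s p q : R) :
  s - 2 * ((c \in L)%:R * p + (c == c)%:R * q) = s - 2 * q.
Proof. by rewrite (negPf cL) eqxx mul0r add0r mul1r. Qed.

Lemma switched_eigenvalue_root (x : R) :
  eigenvalue (seidel R G) (n%:R - 1 - x) -> n%:R - x != 0 ->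
  x * (n%:R - x) ^+ 2 = 4 * t * (n%:R - 1 - t).
Proof.
move=> /seidel_eigenvalueP[y [i yi0] ye] l0.
have -> : n%:R - 1 - t = n%:R - x + x - 1 - t by ring.
have e j : (n%:R - x) * y j = \sum_i y i
      - 2 * ((j \in L)%:R * y c + (j == c)%:R * \sum_(i in L) y i).
  by rewrite -ye; ring.
set s := \sum_i y i in e *; set q := \sum_(i in L) y i in e *.
apply: (@quotient_system_det _ _ _ _ (y c) q s); last first.
  case=> p0 q0 s0; move/eqP: (e i); rewrite p0 q0 s0 !mulr0 addr0 mulr0 subr0.
  by rewrite mulf_eq0 (negPf l0) (negPf yi0).
split.
- by rewrite e star_value_centre.
- by rewrite mulr_sumr (eq_bigr _ (fun j _ => e j)) sum_star_value_leaves.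
- have : (n%:R - x) * s = n%:R * s - 2 * (t * y c + q).
    by rewrite {1}/s mulr_sumr (eq_bigr _ (fun j _ => e j)) sum_star_value.
  lra.
Qed.

Lemma switched_root_eigenvalue (x : R) : 0 < n%:R - x ->
  x * (n%:R - x) ^+ 2 = 4 * t * (n%:R - 1 - t) ->
  eigenvalue (seidel R G) (n%:R - 1 - x).
Proof.
move=> l_gt0 ex; apply/seidel_eigenvalueP.
have [|p [q [s [[e1 e2 e3] nz]]]] := quotient_system_solvable _ _ x t l_gt0.
  by rewrite ex; ring.
have l0 : n%:R - x != 0 by rewrite gt_eqF.
(* Solve the eigenvector equation for y with p, q, s prescribed; the quotient system then makes them
   the actual centre value, leaf sum and total of y. *)
pose y (j : 'I_n) : R :=
  (n%:R - x)^-1 * (s - 2 * ((j \in L)%:R * p + (j == c)%:R * q)).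
have yE j : (n%:R - x) * y j = s - 2 * ((j \in L)%:R * p + (j == c)%:R * q).
  by rewrite /y mulVKf.
have yc : y c = p by apply: (mulfI l0); rewrite yE star_value_centre e1.
have yL : \sum_(i in L) y i = q.
  apply: (mulfI l0).
  by rewrite mulr_sumr (eq_bigr _ (fun j _ => yE j)) sum_star_value_leaves e2.
have ys : \sum_i y i = s.
  apply: (mulfI l0).
  by rewrite mulr_sumr (eq_bigr _ (fun j _ => yE j)) sum_star_value; lra.
exists y; last first.
  move=> j; rewrite yc yL ys.
  have -> : n%:R - 1 - x + 1 = n%:R - x by ring.
  exact: yE.
apply/existsP; rewrite -[X in is_true X]negbK negb_exists.
apply/negP => /forallP yn; case: nz.
have y0 j : y j = 0 by move: (yn j); rewrite negbK => /eqP.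
by rewrite -yc -yL -ys !big1 // y0.
Qed.

End SwitchedStar.

Theorem theorem2p2 (R : realType) (n m : nat) (G : sgraph n)
    (hn : (3 <= n)%N) (hm : (m <= n ^ 2 %/ 4)%N) (hG : is_Hnm m G) :
  let t : R := (min_bip_dist n m)%:R in
  exists xi : R,
    [/\ smallest_sol (fun x : R =>
          x * (n%:R - x) ^+ 2 = 4 * t * (n%:R - 1 - t)) xi,
        largest_eigenvalue (seidel R G) (n%:R - 1 - xi),
        4 * t * (n%:R - 1 - t) / n%:R ^+ 2 <= xi
      & xi <= 4 * t * (n%:R - 1 - t) / (n%:R - 1) ^+ 2].
Proof.
have [A [c [L [cL hL adjE]]]] := @is_Hnm_xor _ _ _ hG; rewrite -hL => t.
have n3 : 3 <= n%:R :> R by rewrite (ler_nat R 3).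
have tn : 0 <= t <= n%:R - 1.
  (* The leaves miss the centre, so there are at most n - 1 of them. *)
  rewrite ler0n /=.
  have : (#|L| < n)%N.
    rewrite -[X in (_ < X)%N]card_ord -cardsT; apply: proper_card.
    by rewrite properT; apply: contraNneq cL => ->; rewrite inE.
  by rewrite -(ler_nat R) -natr1 /t; lra.
have [x x01 fx] := cubic_root_exists _ _ _ tn.
have xmin y := cubic_root_le _ _ _ _ y n3 tn x01 fx.
have /andP[lo hi] := cubic_root_bounds _ _ _ _ n3 x01 fx.
exists x; split=> //; split.
  by apply: (switched_root_eigenvalue _ _ _ _ _ _ cL adjE) => //; lra.
move=> a ea; have -> : a = n%:R - 1 - (n%:R - 1 - a) by ring.
(* The eigenvalue a = -1 need not give a root of the cubic, but it is below n - 1 - x because x <=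
   1. *)
rewrite lerD2l lerN2; have [l0|l0] := eqVneq (a + 1) 0; first by lra.
apply: xmin; apply: (switched_eigenvalue_root _ _ _ _ _ _ cL adjE).
  by rewrite opprB addrC subrK.
by have -> : n%:R - (n%:R - 1 - a) = a + 1 by ring.
Qed.
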